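(* Let $N\ge 1$ and let $(\boldsymbol m^n)_{n\in\mathbb{N}}$ be given by the lattice Boltzmann scheme $\boldsymbol m^{n+1}=\boldsymbol A\boldsymbol m^n+\boldsymbol B\,\boldsymbol m^{\mathrm{eq}}|^n=\boldsymbol A_i\boldsymbol m^n+\boldsymbol A_i^{\diamond}\boldsymbol m^n+\boldsymbol B\,\boldsymbol m^{\mathrm{eq}}|^n$, $i\in\{1,\dots,N\}$. For each $i\in\{1,\dots,N\}$ let $\gamma_{i,0},\dots,\gamma_{i,q+1-N}\in\mathcal{D}$ be the coefficients in the characteristic polynomial $\chi_{\boldsymbol A_i}=X^{N-1}\sum_{k=0}^{q+1-N}\gamma_{i,k}X^k$ of $\boldsymbol A_i$. Then the scheme corresponds to multi-step explicit Finite Difference schemes on the conserved moments $m_1,\dots,m_N$: for every $i\in\{1,\dots,N\}$ and every integer $n\ge q-N$, $$m_i^{n+1}=-\sum_{k=0}^{q-N}\gamma_{i,k}\,m_i^{n-q+N+k}+\left(\sum_{k=0}^{q-N}\Big(\sum_{\ell=0}^{k}\gamma_{i,q+1-N+\ell-k}\boldsymbol A_i^{\ell}\Big)\boldsymbol A_i^{\diamond}\boldsymbol m^{n-k}\right)_i+\left(\sum_{k=0}^{q-N}\Big(\sum_{\ell=0}^{k}\gamma_{i,q+1-N+\ell-k}\boldsymbol A_i^{\ell}\Big)\boldsymbol B\,\boldsymbol m^{\mathrm{eq}}|^{n-k}\right)_i ,$$ and the right-hand side involves only the conserved moments $m_1,\dots,m_N$.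
   Context: Lattice and operators: $d\in\{1,2,3\}$, $\Delta x>0$, $\mathcal{L}=\Delta x\,\mathbb{Z}^d$. For $\boldsymbol z\in\mathbb{Z}^d$ the shift $T^{\boldsymbol z}$ acts on functions $f:\mathcal{L}\to\mathbb{R}$ by $(T^{\boldsymbol z}f)(\boldsymbol x)=f(\boldsymbol x-\boldsymbol z\Delta x)$. $\mathcal{D}$ denotes the commutative ring of Finite Difference operators, i.e. finite real linear combinations of shifts, with composition $T^{\boldsymbol z}\circ T^{\boldsymbol w}=T^{\boldsymbol z+\boldsymbol w}$ as product (the group ring $\mathbb{R}[\mathbb{Z}^d]$). Matrices over $\mathcal{D}$ act on vectors of functions on $\mathcal{L}$ in the obvious way. Lattice Boltzmann scheme: $q\in\mathbb{N}$, number of conserved moments $N\in\{1,\dots,q-1\}$, velocities $\boldsymbol c_1,\dots,\boldsymbol c_q\in\mathbb{Z}^d$, an invertible moment matrix $\boldsymbol M\in\mathrm{GL}_q(\mathbb{R})$, a relaxation matrix $\boldsymbol S=\mathrm{diag}(0,\dots,0,s_{N+1},\dots,s_q)$ ($N$ leading zeros, $s_i\in\,]0,2]$), and a possibly nonlinear function $\boldsymbol m^{\mathrm{eq}}:\mathbb{R}^N\to\mathbb{R}^q$. Put $\boldsymbol T=\boldsymbol M\,\mathrm{diag}(T^{\boldsymbol c_1},\dots,T^{\boldsymbol c_q})\boldsymbol M^{-1}$, $\boldsymbol A=\boldsymbol T(\boldsymbol I-\boldsymbol S)$, $\boldsymbol B=\boldsymbol T\boldsymbol S$, all in $\mathcal{M}_q(\mathcal{D})$.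 The moments $\boldsymbol m^n=(m_1^n,\dots,m_q^n)^{\mathsf T}$, $m_j^n:\mathcal{L}\to\mathbb{R}$, evolve from arbitrary initial data $\boldsymbol m^0$ by $\boldsymbol m^{n+1}=\boldsymbol A\boldsymbol m^n+\boldsymbol B\,\boldsymbol m^{\mathrm{eq}}|^n$, $n\in\mathbb{N}$, where $\boldsymbol m^{\mathrm{eq}}|^n(\boldsymbol x)=\boldsymbol m^{\mathrm{eq}}(m_1^n(\boldsymbol x),\dots,m_N^n(\boldsymbol x))$. For $i\in\{1,\dots,N\}$, $\boldsymbol A_i\in\mathcal{M}_q(\mathcal{D})$ is obtained from $\boldsymbol A$ by keeping the entries whose row and column indices both lie in $\{i\}\cup\{N+1,\dots,q\}$ and setting all other entries to zero; $\boldsymbol A_i^{\diamond}=\boldsymbol A-\boldsymbol A_i$. Powers use $\boldsymbol A_i^0=\boldsymbol I$. The characteristic polynomial of $\boldsymbol C\in\mathcal{M}_r(\mathcal{R})$ over a commutative ring $\mathcal{R}$ is $\chi_{\boldsymbol C}=(-1)^r\det(\boldsymbol C-X\boldsymbol I)\in\mathcal{R}[X]$ (monic). $(\cdot)_i$ denotes the $i$-th component of a vector. *)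

(* Defs.v *)
From HB Require Import structures.
From mathcomp Require Import all_boot all_order all_algebra.
From mathcomp Require Import boolp classical_sets functions reals.
Set Implicit Arguments.
Unset Strict Implicit.
Unset Printing Implicit Defensive.
Import Order.TTheory GRing.Theory Num.Theory.
Local Open Scope ring_scope.

Section Lattice.
Context {R : realType} {d : nat}.
Variable dx : R.

Definition lattice_pred : {pred 'rV[R]_d} :=
  fun x => `[< exists z : 'rV[int]_d, x = dx *: map_mx intr z >].

Lemma lattice_zmod_closed : zmod_closed lattice_pred.
Proof.
split; first by apply/asboolP; exists 0; rewrite map_mx0 scaler0.
move=> _ _ /asboolP[z ->] /asboolP[w ->]; apply/asboolP; exists (z - w).
by rewrite map_mxB scalerBr.
Qed.

HB.instance Definition _ :=
  GRing.isZmodClosed.Build _ lattice_pred lattice_zmod_closed.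

Record lattice := Lattice { lval : 'rV[R]_d; lvalP : lval \in lattice_pred }.

HB.instance Definition _ := [isSub for lval].
HB.instance Definition _ := [Choice of lattice by <:].
HB.instance Definition _ := [SubChoice_isSubZmodule of lattice by <:].

Lemma site_subproof (z : 'rV[int]_d) :
  dx *: map_mx intr z \in lattice_pred.
Proof. by apply/asboolP; exists z. Qed.

Definition site (z : 'rV[int]_d) : lattice := Lattice (site_subproof z).

Lemma siteD z w : site (z + w) = site z + site w.
Proof. by apply: val_inj; rewrite raddfD /= map_mxD scalerDr. Qed.

Lemma site0 : site 0 = 0.
Proof. by apply: val_inj; rewrite raddf0 /= map_mx0 scaler0. Qed.

(* R^o is R seen as a module over itself: lattice -> R^o is just the type of
   real functions on the lattice, with its R-module structure. *)
Definition shiftf (z : 'rV[int]_d) (f : lattice -> R^o) : lattice -> R^o :=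
  fun x => f (x - site z).

Definition fd_pred : {pred (lattice -> R^o) -> (lattice -> R^o)} :=
  fun D => `[< exists s : seq (R * 'rV[int]_d),
                 forall f, D f = \sum_(t <- s) t.1 *: shiftf t.2 f >].

Lemma shiftfD z w f : shiftf z (shiftf w f) = shiftf (z + w) f.
Proof. by apply/funext => x; rewrite /shiftf siteD opprD addrA. Qed.

Lemma shiftf0 f : shiftf 0 f = f.
Proof. by apply/funext => x; rewrite /shiftf site0 subr0. Qed.

Lemma shiftf_is_linear z : linear (shiftf z).
Proof. by []. Qed.

HB.instance Definition _ z :=
  GRing.isLinear.Build R (lattice -> R^o) (lattice -> R^o) _ (shiftf z)
    (shiftf_is_linear z).

Lemma shiftfZ z a f : shiftf z (a *: f) = a *: shiftf z f.
Proof. by []. Qed.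

Lemma fd_subsemimod_closed : subsemimod_closed fd_pred.
Proof.
apply: GRing.submod_closed_semi; split.
  by apply/asboolP; exists [::] => f; rewrite big_nil.
move=> a D E /asboolP[s Ds] /asboolP[t Et]; apply/asboolP.
exists ([seq (a * u.1, u.2) | u <- s] ++ t) => f.
rewrite big_cat big_map /= -Et; congr (_ + _).
rewrite [LHS](_ : _ = a *: D f) // Ds scaler_sumr.
by apply: eq_bigr => u _; rewrite scalerA.
Qed.

HB.instance Definition _ :=
  GRing.isSubmodClosed.Build R _ fd_pred fd_subsemimod_closed.

Lemma shift_subproof z : shiftf z \in fd_pred.
Proof.
by apply/asboolP; exists [:: (1, z)] => f; rewrite big_seq1 scale1r.
Qed.

Lemma fd_comp_subproof D E :
  D \in fd_pred -> E \in fd_pred -> D \o E \in fd_pred.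
Proof.
move=> /asboolP[s Ds] /asboolP[t Et]; apply/asboolP.
exists [seq (u.1 * v.1, u.2 + v.2) | u <- s, v <- t] => f.
rewrite big_allpairs_dep /= Ds; apply: eq_bigr => u _.
rewrite Et linear_sum /= scaler_sumr; apply: eq_bigr => v _.
by rewrite shiftfZ scalerA shiftfD.
Qed.

Lemma fd_comp_comm D E : D \in fd_pred -> E \in fd_pred -> D \o E = E \o D.
Proof.
move=> /asboolP[s Ds] /asboolP[t Et]; apply/funext => f /=.
rewrite Ds Et [RHS]Et [in RHS]Ds.
under eq_bigr => u _ do rewrite linear_sum /= scaler_sumr.
under [RHS]eq_bigr => u _ do rewrite linear_sum /= scaler_sumr.
rewrite exchange_big; apply: eq_bigr => u _; apply: eq_bigr => v _.
by rewrite !shiftfZ !scalerA !shiftfD mulrC addrC.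
Qed.

(* The ring of finite difference operators: its elements are operators on
   lattice functions, its product is composition, and real scalars embed
   through the R-algebra structure. *)
Record fd := FD {
  fd_op :> (lattice -> R^o) -> (lattice -> R^o);
  fd_opP : fd_op \in fd_pred
}.

HB.instance Definition _ := [isSub for fd_op].
HB.instance Definition _ := [Choice of fd by <:].
HB.instance Definition _ := [SubChoice_isSubLmodule of fd by <:].

Definition shift (z : 'rV[int]_d) : fd := FD (shift_subproof z).

Definition fd_mul (D E : fd) : fd :=
  FD (fd_comp_subproof (fd_opP D) (fd_opP E)).

Fact fd_mulA : associative fd_mul.
Proof. by move=> D E F; apply: val_inj. Qed.

Fact fd_mulC : commutative fd_mul.
Proof.
by move=> D E; apply: val_inj; apply: fd_comp_comm; apply: fd_opP.
Qed.

Fact fd_mul1 : left_id (shift 0) fd_mul.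
Proof. by move=> D; apply: val_inj; apply/funext => f /=; rewrite shiftf0. Qed.

Fact fd_mulDl : left_distributive fd_mul +%R.
Proof. by move=> D E F; apply: val_inj; rewrite raddfD /=. Qed.

Fact fd_oner_neq0 : shift 0 != 0.
Proof.
apply/eqP => /(congr1 val); rewrite raddf0 /=.
move=> /(congr1 (fun D => D (fun=> 1) 0)); rewrite shiftf0.
by move=> /eqP; rewrite oner_eq0.
Qed.

HB.instance Definition _ := GRing.Zmodule_isComNzRing.Build fd
  fd_mulA fd_mulC fd_mul1 fd_mulDl fd_oner_neq0.

Fact fd_scalerAl (a : R) (D E : fd) : a *: (D * E) = (a *: D) * E.
Proof. by apply: val_inj; rewrite linearZ /=. Qed.

HB.instance Definition _ := GRing.Lmodule_isLalgebra.Build R fd fd_scalerAl.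

End Lattice.

Arguments lattice {R} d dx.
Arguments fd {R} d dx.
Arguments shift {R d} dx z.

Section Action.
Context {R : realType} {d : nat} {dx : R}.

Definition fd_act {p r : nat} (C : 'M[fd d dx]_(p, r))
    (u : 'cV[lattice d dx -> R^o]_r) : 'cV[lattice d dx -> R^o]_p :=
  \col_j \sum_k C j k (u k 0).

End Action.

Section Scheme.
Context {R : realType} {d : nat} {dx : R} {q : nat}.
Implicit Types (M : 'M[R]_q) (c : 'I_q -> 'rV[int]_d) (s : 'I_q -> R).

(* Indices are 0-based: the conserved moments are those of index j < N, and
   the values of s at these indices are irrelevant. *)
Definition relaxation_mx (N : nat) s : 'M[R]_q :=
  diag_mx (\row_j if (j < N)%N then 0 else s j).

Definition lift_mx (C : 'M[R]_q) : 'M[fd d dx]_q := map_mx (in_alg (fd d dx)) C.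

Definition transport_mx M c : 'M[fd d dx]_q :=
  lift_mx M *m diag_mx (\row_j shift dx (c j)) *m lift_mx (invmx M).

Definition lbm_A (N : nat) M c s : 'M[fd d dx]_q :=
  transport_mx M c *m lift_mx (1%:M - relaxation_mx N s).

Definition lbm_B (N : nat) M c s : 'M[fd d dx]_q :=
  transport_mx M c *m lift_mx (relaxation_mx N s).

Definition equilibrium (N : nat) (leNq : (N <= q)%N)
    (meq : 'cV[R]_N -> 'cV[R]_q) (u : 'cV[lattice d dx -> R^o]_q) :
    'cV[lattice d dx -> R^o]_q :=
  \col_j (fun x => meq (\col_l u (widen_ord leNq l) 0 x) j 0).

Definition keep_mx (N : nat) (C : 'M[fd d dx]_q) (i : 'I_q) : 'M[fd d dx]_q :=
  \matrix_(j, k)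
    if ((j == i) || (N <= j)%N) && ((k == i) || (N <= k)%N) then C j k else 0.

End Scheme.

Arguments lift_mx {R d} dx {q} C.
Arguments transport_mx {R d} dx {q} M c.
Arguments lbm_A {R d} dx {q} N M c s.
Arguments lbm_B {R d} dx {q} N M c s.

(* The library's char_poly, \det ('X%:M - C), agrees with the other usual
   normalisation of the monic characteristic polynomial. *)
Lemma char_poly_signE (K : comNzRingType) (r : nat) (C : 'M[K]_r) :
  char_poly C = (-1) ^+ r * \det (map_mx polyC C - 'X%:M).
Proof. by rewrite -detZ scaleN1r opprB. Qed.

(* Main.v *)
Require Import Defs.
From HB Require Import structures.
From mathcomp Require Import all_boot all_order all_algebra.
From mathcomp Require Import boolp classical_sets functions reals.
From mathcomp Require Import zify.

(* Let chi = X^(N-1) p be the characteristic polynomial of A_i. The factor p is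
   that of the block of A_i on J = {i} u {N+1, ..., q}, so row i of p(A_i)
   vanishes by Cayley-Hamilton for that block. With r = q - N, the matrices
     P_k = sum_(l <= k) gamma_(r+1+l-k) A_i^l
   are the Horner quotients of p at A_i: P_0 = 1,
   P_(k+1) = gamma_(r-k) + P_k A_i and P_(r+1) = p(A_i). Substituting
   m^(n-k+1) = A_i m^(n-k) + f^(n-k) in P_k m^(n-k+1) for k = 0, ..., r
   therefore telescopes to the scheme on m_i. Finally, row i of P_k is supported
   on the columns in J, while the rows of A - A_i in J are supported on the
   conserved columns other than i. *)

Set Implicit Arguments.
Unset Strict Implicit.
Unset Printing Implicit Defensive.
Import Order.TTheory GRing.Theory Num.Theory.
Local Open Scope ring_scope.

(** * Characteristic polynomial of a matrix supported on an index block *)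

Section PolynomialMatrices.
Variable K : comNzRingType.

(* Substituting C for X on the right of the coefficients of w: the right-hand
   factor X - C then vanishes, whence the telescoping sum. *)
Lemma annihilating_row (n : nat) (C : 'M[K]_n) (p : {poly K}) (v : 'rV[K]_n)
    (w : 'rV[{poly K}]_n) :
  p *: map_mx polyC v = w *m ('X%:M - map_mx polyC C) ->
  forall b, (size p <= b)%N -> v *m (\sum_(k < b) p`_k *: C ^+ k) = 0.
Proof.
rewrite mulmxBr mul_mx_scalar => pvE.
pose wc k : 'rV[K]_n := \row_j (w 0 j)`_k.
have coefE k : p`_k *: v = (if k is k'.+1 then wc k' else 0) - wc k *m C.
  apply/rowP => j; move/rowP/(_ j)/(congr1 (coefp k)): pvE.
  rewrite !mxE /= coefMC => ->; rewrite coefB coefXM.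
  congr (_ - _); first by case: k => [|k] /=; rewrite mxE.
  by rewrite coef_sum; apply: eq_bigr => l _; rewrite !mxE coefMC.
have partialE b : v *m (\sum_(k < b.+1) p`_k *: C ^+ k) = - (wc b *m C ^+ b.+1).
  elim: b => [|b IHb].
    by rewrite big_ord1 expr0 -scalemxAr mulmx1 (coefE 0) sub0r expr1.
  rewrite big_ord_recr /= mulmxDr IHb -scalemxAr scalemxAl (coefE b.+1).
  by rewrite mulmxBl -mulmxA -[C *m _]/(C * _) -exprS addrA addNr add0r.
(* [e] bounds the size of every entry of [w], so the boundary term [wc e *m C ^+ e.+1] vanishes; the
   terms from [b] to [e] vanish because [size p <= b]. *)
move=> b le_pb; pose e := (b + \max_(j < n) size (w 0%R j))%N.
have := partialE e.
have -> : wc e = 0.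
  apply/rowP => j; rewrite !mxE nth_default //.
  by rewrite (leq_trans _ (leq_addl _ _)) // (leq_bigmax j).
rewrite mul0mx oppr0 => <-; congr (_ *m _).
have le_be : (b <= e.+1)%N by rewrite ltnW // ltnS leq_addr.
rewrite -!(big_mkord xpredT (fun k => p`_k *: C ^+ k)).
rewrite [RHS](big_cat_nat (n := b)) //= [X in _ + X]big1_seq ?addr0 // => k.
rewrite mem_index_iota => /andP[_ /andP[le_bk _]].
by rewrite nth_default ?scale0r // (leq_trans le_pb).
Qed.

Variables (n : nat) (J : pred 'I_n) (C : 'M[K]_n).
Hypothesis C_supp : forall j k, ~~ (J j && J k) -> C j k = 0.

(* Its determinant is the characteristic polynomial of the block of C indexed
   by J; filling up with rows of the identity avoids reindexing that block. *)
Definition block_char_mx : 'M[{poly K}]_n :=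
  \matrix_(j, k) if J j then char_poly_mx C j k else (j == k)%:R.

(** A row of X - [C] outside [J] is X times a row of the identity, so each such row contributes a
    factor X to the determinant. *)
Lemma char_poly_block :
  char_poly C = 'X^#|[predC J]| * \det block_char_mx.
Proof.
rewrite /char_poly; have -> : char_poly_mx C
        = diag_mx (\row_j if J j then 1 else 'X) *m block_char_mx.
  apply/matrixP => j k; rewrite mul_diag_mx !mxE.
  case: ifPn => Jj; rewrite ?mul1r // C_supp ?(negPf Jj) // subr0.
  by rewrite mulr_natr.
rewrite det_mulmx det_diag; congr (_ * _).
rewrite -prodr_const [RHS]big_mkcond; apply: eq_bigr => j _.
by rewrite mxE inE unfold_in; case: (J j).
Qed.

(** Row [i] of the adjugate, cut down to [J], multiplies X - [C] into the determinant times the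
    [i]-th unit row; [annihilating_row] then applies. *)
Lemma block_Cayley_Hamilton (i : 'I_n) : J i ->
  forall b, (size (\det block_char_mx) <= b)%N ->
  row i (\sum_(k < b) (\det block_char_mx)`_k *: C ^+ k) = 0.
Proof.
move=> Ji b le_b; rewrite rowE.
pose w := \row_j if J j then \adj block_char_mx i j else 0.
apply: (annihilating_row (w := w)) le_b.
apply/rowP => k.
have /matrixP/(_ i k) := mul_adj_mx block_char_mx.
rewrite !mxE => adjE; case: (boolP (J k)) => Jk.
  rewrite eq_sym -[_ *+ _]mulr_natr in adjE.
  rewrite polyCMn -adjE; apply: eq_bigr => j _.
  rewrite [block_char_mx j k]mxE [w 0 j]mxE -/(char_poly_mx C).
  case: ifPn => // Jj; rewrite mul0r (_ : (j == k) = false) ?mulr0 //.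
  by apply: contraNF Jj => /eqP ->.
(* For [k] outside [J], column [k] of X - [C] is zero in the rows of [J], where [w] is supported. *)
have -> : (k == i) = false by apply: contraNF Jk => /eqP ->.
rewrite mulr0 big1 // => j _; rewrite !mxE.
case: ifPn => Jj; last by rewrite mul0r.
rewrite C_supp ?(negPf Jk) ?andbF // subr0.
by rewrite (_ : (j == k) = false) ?mulr0 //; apply: contraNF Jk => /eqP <-.
Qed.

End PolynomialMatrices.

(** * Linearity and composition of the action of finite difference matrices *)

Section Action.
Variables (R : realType) (d : nat) (dx : R).
Local Notation fdR := (fd d dx).
Local Notation func := (lattice d dx -> R^o).

Lemma fd_op_is_linear (D : fdR) : linear (fd_op D).
Proof.
move=> a f g; have /asboolP[s Ds] := fd_opP D.
rewrite !Ds scaler_sumr -big_split /=; apply: eq_bigr => t _.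
by rewrite shiftf_is_linear scalerDr !scalerA mulrC.
Qed.

HB.instance Definition _ (D : fdR) :=
  GRing.isLinear.Build R func func _ (fd_op D) (fd_op_is_linear D).

Lemma fd_op_suml (I : Type) (r : seq I) (P : pred I) (D : I -> fdR) (f : func) :
  (\sum_(k <- r | P k) D k) f = \sum_(k <- r | P k) D k f.
Proof.
by elim/big_rec2: _ => [|k g E _ <-].
Qed.

Lemma fd_actDr p r (C : 'M[fdR]_(p, r)) (u v : 'cV[func]_r) :
  fd_act C (u + v) = fd_act C u + fd_act C v.
Proof.
apply/colP => j; rewrite !mxE -big_split; apply: eq_bigr => k _.
by rewrite mxE raddfD.
Qed.

Lemma fd_actDl p r (C D : 'M[fdR]_(p, r)) u :
  fd_act (C + D) u = fd_act C u + fd_act D u.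
Proof.
by apply/colP => j; rewrite !mxE -big_split; apply: eq_bigr => k _; rewrite mxE.
Qed.

Lemma fd_actM p r t (C : 'M[fdR]_(p, r)) (D : 'M[fdR]_(r, t)) u :
  fd_act (C *m D) u = fd_act C (fd_act D u).
Proof.
apply/colP => j; rewrite !mxE.
under eq_bigr do rewrite mxE fd_op_suml.
rewrite exchange_big; apply: eq_bigr => k _.
by rewrite mxE raddf_sum.
Qed.

Lemma fd_act_scalar p (a : fdR) (u : 'cV[func]_p) j :
  fd_act a%:M u j 0 = a (u j 0).
Proof.
rewrite mxE (bigD1 j) //= mxE eqxx mulr1n big1 ?addr0 // => k /negPf nkj.
by rewrite mxE eq_sym nkj.
Qed.

Lemma eq_fd_act p r (C : 'M[fdR]_(p, r)) (u v : 'cV[func]_r) j :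
  (forall k, C j k != 0 -> u k 0 = v k 0) -> fd_act C u j 0 = fd_act C v j 0.
Proof.
move=> uv; rewrite !mxE; apply: eq_bigr => k _.
by have [->//|/uv->] := eqVneq (C j k) 0.
Qed.

Lemma fd_act_row0 p r (C : 'M[fdR]_(p, r)) (u : 'cV[func]_r) j :
  row j C = 0 -> fd_act C u j 0 = 0.
Proof.
move=> /rowP Cj0; rewrite mxE big1 // => k _.
by have := Cj0 k; rewrite !mxE => ->.
Qed.

(** * Horner quotients and the telescoped recurrence *)

Variables (q r : nat) (C : 'M[fdR]_q) (g : nat -> fdR).

Definition horner_quotient_mx k : 'M[fdR]_q :=
  \sum_(l < k.+1) g (r.+1 + l - k)%N *: C ^+ l.

Lemma horner_quotient_mxS k :
  horner_quotient_mx k.+1 = (g (r - k)%N)%:M + horner_quotient_mx k *m C.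
Proof.
rewrite /horner_quotient_mx big_ord_recl /= expr0 scalemx1 addn0 subSS.
congr (_ + _); rewrite mulmx_suml; apply: eq_bigr => l _.
by rewrite -scalemxAl addnS subSS exprSr.
Qed.

(** Each step of the induction on [b] expands [y (n.+1 - b)] by the recurrence and replaces
    [horner_quotient_mx b *m C] by the next quotient minus the scalar matrix of [g (r - b)]. *)
Lemma fd_recurrence_telescope (y f : nat -> 'cV[func]_q) :
  (forall t, y t.+1 = fd_act C (y t) + f t) ->
  forall n b, (b <= n.+1)%N ->
  fd_act (horner_quotient_mx 0) (y n.+1)
    = fd_act (horner_quotient_mx b) (y (n.+1 - b)%N)
      - \sum_(k < b) fd_act (g (r - k)%N)%:M (y (n - k)%N)
      + \sum_(k < b) fd_act (horner_quotient_mx k) (f (n - k)%N).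
Proof.
move=> yS n; elim=> [_|b IHb lt_bn].
  by rewrite !big_ord0 subr0 addr0 subn0.
rewrite (IHb (ltnW lt_bn)) subSS subSn // yS !big_ord_recr /=.
rewrite horner_quotient_mxS fd_actDr fd_actDl -fd_actM.
set a := fd_act _ _; set e := fd_act _ _; set h := fd_act _%:M _.
set S := \sum_(_ < _) _; set S' := \sum_(_ < _) _.
by rewrite [h + a]addrC [S + h]addrC addrKA [S' + e]addrC addrA (addrAC a).
Qed.

End Action.

Theorem proposition6 (R : realType) (d : nat) (hd : (1 <= d <= 3)%N)
    (dx : R) (hdx : 0 < dx)
    (q N : nat) (hN : (0 < N)%N) (hNq : (N < q)%N)
    (c : 'I_q -> 'rV[int]_d)
    (M : 'M[R]_q) (hM : M \in unitmx)
    (s : 'I_q -> R) (hs : forall j : 'I_q, (N <= j)%N -> 0 < s j <= 2)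
    (meq : 'cV[R]_N -> 'cV[R]_q)
    (m : nat -> 'cV[lattice d dx -> R^o]_q)
    (hm : forall n : nat,
       m n.+1 = fd_act (lbm_A dx N M c s) (m n)
              + fd_act (lbm_B dx N M c s) (equilibrium (ltnW hNq) meq (m n)))
    (i : 'I_q) (hi : (i < N)%N) :
  let A := lbm_A dx N M c s in
  let B := lbm_B dx N M c s in
  let Ai := keep_mx N A i in
  let Aid := A - Ai in
  let gamma (k : nat) : fd d dx := (char_poly Ai)`_(N.-1 + k) in
  let P (k : nat) : 'M[fd d dx]_q :=
    \sum_(l < k.+1) gamma (q.+1 - N + l - k)%N *: Ai ^+ l in
  let rhs (u : nat -> 'cV[lattice d dx -> R^o]_q) (n : nat) : lattice d dx -> R^o :=
    - (\sum_(k < (q - N).+1) gamma k (u (n - (q - N) + k)%N i 0))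
    + (\sum_(k < (q - N).+1) fd_act (P k) (fd_act Aid (u (n - k)%N))) i 0
    + (\sum_(k < (q - N).+1)
         fd_act (P k) (fd_act B (equilibrium (ltnW hNq) meq (u (n - k)%N)))) i 0
  in
  [/\ char_poly Ai
        = 'X^(N.-1) * \sum_(k < (q.+1 - N).+1) gamma k *: 'X^k,
      forall n : nat, (q - N <= n)%N -> m n.+1 i 0 = rhs m n
    & forall (n : nat) (u v : nat -> 'cV[lattice d dx -> R^o]_q),
        (q - N <= n)%N ->
        (forall (t : nat) (j : 'I_q), (n - (q - N) <= t <= n)%N -> (j < N)%N ->
           u t j 0 = v t j 0) ->
        rhs u n = rhs v n].
Proof.
move=> A B Ai Aid gamma P rhs.
pose r := (q - N)%N.
have rS : (q.+1 - N = r.+1)%N by rewrite subSn // ltnW.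
pose J : pred 'I_q := fun j => (j == i) || (N <= j)%N.
have Ji : J i by rewrite /J eqxx.
have AiJ j k : ~~ (J j && J k) -> Ai j k = 0.
  by rewrite mxE /J => /negPf ->.
pose p := \det (block_char_mx J Ai).
(* The complement of [J] consists of the conserved indices other than [i]. *)
have cardJ : #|[predC J]| = N.-1.
  pose L := [pred j : 'I_q | (j < N)%N].
  have cardL : #|L| = N.
    by rewrite -sum1_card (big_ord_narrow (ltnW hNq)) sum1_card card_ord.
  rewrite -[in RHS]cardL (cardD1 i L) (hi : i \in L) add1n /=.
  apply: eq_card => j.
  by rewrite !inE unfold_in /J negb_or -ltnNge.
have charE : char_poly Ai = 'X^(N.-1) * p.
  by rewrite (char_poly_block AiJ) cardJ.
have gammaE k : gamma k = p`_k.
  by rewrite /gamma charE coefXnM ltnNge leq_addr addKn.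
(* [char_poly Ai] has size q + 1 = (N - 1) + (r + 2). *)
have size_p : (size p <= r.+2)%N.
  apply/leq_sizeP => k le_rk; rewrite -gammaE /gamma nth_default //.
  rewrite size_char_poly /r in le_rk *; lia.
have PE : P =1 horner_quotient_mx r Ai gamma.
  by move=> k; rewrite /P rS.
have gammar : gamma r.+1 = 1.
  have /monicP := char_poly_monic Ai.
  rewrite /lead_coef size_char_poly /= => <-; congr (_`_ _); rewrite /r; lia.
split.
- rewrite charE; congr (_ * _); rewrite rS.
  under eq_bigr do rewrite gammaE.
  rewrite -poly_def; apply/polyP => k; rewrite coef_poly.
  by case: ltnP => // le_rk; rewrite nth_default // (leq_trans size_p).
- move=> n le_rn.
  pose f t := fd_act Aid (m t) + fd_act B (equilibrium (ltnW hNq) meq (m t)).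
  have mS t : m t.+1 = fd_act Ai (m t) + f t.
    by rewrite hm /f addrA -fd_actDl [Ai + _]addrC subrK.
  have := fd_recurrence_telescope r gamma mS (le_rn : (r.+1 <= n.+1)%N).
  move/(congr1 (fun u : 'cV[lattice d dx -> R^o]_q => u i 0)).
  rewrite {1}/horner_quotient_mx big_ord1 addn0 subn0 gammar scale1r.
  rewrite fd_act_scalar [fd_op 1 _]shiftf0 => ->.
  (* At k = r + 1 the index r + 1 + l - k is just l, so this quotient is p([Ai]). *)
  have row0 : row i (horner_quotient_mx r Ai gamma r.+1) = 0.
    rewrite -[RHS](block_Cayley_Hamilton AiJ Ji size_p); congr (row i _).
    by apply: eq_bigr => k _; rewrite addKn gammaE.
  rewrite 2![in LHS]mxE (fd_act_row0 _ row0) add0r /rhs -addrA; congr (_ + _).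
    (* Telescoping pairs [gamma (r - k)] with time n - k; reversing the sum pairs [gamma k] with
       time n - r + k. *)
    rewrite mxE summxE (reindex_inj rev_ord_inj); congr (- _).
    apply: eq_bigr => k _; rewrite fd_act_scalar /= subSS subKn -1?ltnS //.
    by rewrite subnBA 1?addnBAC // -ltnS.
  rewrite !summxE -big_split; apply: eq_bigr => k _.
  by rewrite PE fd_actDr mxE.
- move=> n u v le_rn uv.
  (* As [i] lies in [J], row [i] of every power of [Ai], the identity included, is supported on
     [J]. *)
  have PJ k j : ~~ J j -> P k i j = 0.
    move=> nJj; rewrite /P summxE big1 // => l _; rewrite mxE.
    suff -> : (Ai ^+ l) i j = 0 by rewrite mulr0.
    have nij : (i == j) = false by apply: contraNF nJj => /eqP <-.
    case: (val l) => [|l']; first by rewrite mxE nij.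
    rewrite exprSr mxE big1 // => x _.
    by rewrite AiJ ?mulr0 // negb_and nJj orbT.
  have PAJ k j : J j -> (P k *m Aid) i j = 0.
    move=> Jj; rewrite mxE big1 // => x _.
    case: (boolP (J x)) => Jx; last by rewrite PJ ?mul0r.
    by rewrite !mxE -/(J x) -/(J j) Jx Jj subrr mulr0.
  have range k : (k < r.+1)%N -> (n - r <= n - k <= n)%N by lia.
  rewrite /rhs; congr (- _ + _ + _).
  - apply: eq_bigr => k _; rewrite uv //; have := ltn_ord k; lia.
  - rewrite !summxE; apply: eq_bigr => k _; rewrite -!fd_actM.
    apply: eq_fd_act => j.
    case: (boolP (J j)) => [/PAJ->|]; first by rewrite eqxx.
    rewrite negb_or -ltnNge => /andP[_ ltjN] _.
    by apply: uv => //; apply: range.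
  - rewrite !summxE; apply: eq_bigr => k _.
    (* All components of the two equilibria agree, since they read only moments of index below
       [N]. *)
    congr (fun_of_matrix (fd_act _ (fd_act _ _)) _ _); apply/colP => j.
    rewrite !mxE; apply/funext => x; congr (meq _ j 0).
    apply/colP => l; rewrite !mxE.
    by rewrite (uv _ (widen_ord _ l) (range k _) (ltn_ord l)).
Qed.
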